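(* Let $X$ and $Y$ be reflexive Banach spaces, let $\Omega\subset X$ be closed and convex, let $\Lambda_1,\Lambda_2\subset X\times Y$ be closed sets, and let $(\bar x,\bar y)$ be a local extremal point of the system $\{\Lambda_1,\Lambda_2\}$ relative to $\Omega$. Then for any $\varepsilon>0$ there exist pairs $(x_i,y_i)\in\Lambda_i\cap[(\bar x+\varepsilon B_X)\times(\bar y+\varepsilon B_Y)]$ and $(x_i^*,y_i^* )\in X^*\times Y^*$, $i=1,2$, such that $$(x_i^*,y_i^* )\in\big[\widehat N\big((x_i,y_i);\Lambda_i\big)+\varepsilon(B_{X^*}\times B_{Y^*})\big]\cap\big[J(T(x_i;\Omega))\times Y^*\big],\quad i=1,2,$$ $$(x_1^*,y_1^* )+(x_2^*,y_2^* )=0,\qquad\|(x_1^*,y_1^* )\|_{X^*\times Y^*}+\|(x_2^*,y_2^* )\|_{X^*\times Y^*}=1.$$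
   Context: Conventions: every reflexive Banach space is equipped with an equivalent norm such that both the space and its dual are locally uniformly convex and the norm is Fréchet differentiable at each nonzero point. Products carry the norm $\|(x,y)\|_{X\times Y}=\sqrt{\|x\|^2+\|y\|^2}$, and similarly $\|(x^*,y^* )\|_{X^*\times Y^*}=\sqrt{\|x^*\|^2+\|y^*\|^2}$. $B_X,B_Y,B_{X^*},B_{Y^*}$ are closed unit balls. Local extremal point: for nonempty $\Lambda_1,\Lambda_2\subset X\times Y$ and $\Omega\subset X$, a point $(\bar x,\bar y)\in\Lambda_1\cap\Lambda_2$ is a local extremal point of $\{\Lambda_1,\Lambda_2\}$ relative to $\Omega$ if $\Pi_X(\Lambda_1\cup\Lambda_2)\subset\Omega$ (where $\Pi_X$ is the projection of $X\times Y$ onto $X$) and there exist a sequence $\{b_k\}\subset Y$ with $b_k\to0$ and a neighborhood $U$ of $(\bar x,\bar y)$ such that $(\Lambda_1+(0,b_k))\cap\Lambda_2\cap U=\emptyset$ for all large $k\in\mathbb N$. Regular normal cone: for $\Lambda\subset Z$, $\bar z\in\Lambda$, $\widehat N(\bar z;\Lambda)=\{z^*\in Z^*\mid\limsup_{z\to\bar z,\,z\in\Lambda}\frac{\langle z^*,z-\bar z\rangle}{\|z-\bar z\|}\le0\}$ (limsup over $z\ne\bar z$; vacuous if $\bar z$ is isolated in $\Lambda$). Duality mapping: $J(x)=\{x^*\in X^*\mid\langle x^*,x\rangle=\|x\|^2,\ \|x^*\|=\|x\|\}$; $J(A)=\bigcup_{x\in A}J(x)$. Tangent (contingent) cone: $w\in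 T(\bar x;\Omega)$ iff there are $t_k>0$, $t_k\to0$, $w_k\to w$ with $\bar x+t_kw_k\in\Omega$ for all $k$. *)

(* Defs.v *)
From HB Require Import structures.
From mathcomp Require Import all_boot all_order all_algebra.
From mathcomp Require Import all_classical all_reals all_analysis.
Set Implicit Arguments.
Unset Strict Implicit.
Unset Printing Implicit Defensive.
Import Order.TTheory GRing.Theory Num.Theory.
Import numFieldNormedType.Exports.
Local Open Scope classical_set_scope.
Local Open Scope ring_scope.

(* The topological dual of a normed space, as a normed space. *)
Section Dual.
Context (R : realType) (X : normedModType R).

Definition dual_pred : {pred X -> R^o} :=
  mem [set f : X -> R^o | linear f /\ continuous f].

Structure dual := Dual {
  dual_fun :> X -> R^o;
  _ : dual_fun \in dual_pred }.

HB.instance Definition _ := [isSub for dual_fun].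
HB.instance Definition _ := [Choice of dual by <:].

Fact dual_pred_submod_closed : submod_closed dual_pred.
Proof.
split=> [|a f g]; rewrite !inE /=.
  split; last exact: cst_continuous.
  by move=> a x y; rewrite scaler0 addr0.
move=> [lf cf] [lg cg]; split.
  move=> b x y; rewrite !fctE /= lf lg !scalerDr !scalerA mulrC.
  by rewrite addrACA.
move=> x; apply: cvgD; last exact: cg.
by apply: cvgZr; exact: cf.
Qed.
HB.instance Definition _ :=
  GRing.isSubmodClosed.Build R (X -> R^o) dual_pred dual_pred_submod_closed.
HB.instance Definition _ := [SubChoice_isSubLmodule of dual by <:].

Fact dual_is_linear (f : dual) : linear f.
Proof. by have := valP f; rewrite inE => -[]. Qed.
HB.instance Definition _ (f : dual) :=
  GRing.isLinear.Build R X R^o _ (dual_fun f) (dual_is_linear f).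

Fact dual_is_continuous (f : dual) : continuous f.
Proof. by have := valP f; rewrite inE => -[]. Qed.

Definition dual_norm (f : dual) : R :=
  sup [set `|f x| | x in [set x : X | `|x| <= 1]].

Fact dual_norm_has_sup (f : dual) :
  has_sup [set `|f x| | x in [set x : X | `|x| <= 1]].
Proof.
split; first by exists `|f 0|, 0 => //=; rewrite normr0.
have /bounded_funP/(_ 1)[M fM] :
    bounded_near (f : {linear X -> R^o}) (nbhs (0 : X)).
  by apply/linear_bounded_continuous; exact: dual_is_continuous.
by exists M => _ [x /= x1 <-]; exact: fM.
Qed.

Fact dual_norm_ge (f : dual) (x : X) : `|x| <= 1 -> `|f x| <= dual_norm f.
Proof.
by move=> x1; apply: ub_le_sup; [exact: (dual_norm_has_sup f).2|exists x].
Qed.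

Fact dual_norm_le (f : dual) (M : R) :
  (forall x : X, `|x| <= 1 -> `|f x| <= M) -> dual_norm f <= M.
Proof.
move=> fM; apply: ge_sup; first exact: (dual_norm_has_sup f).1.
by move=> _ [x /= x1 <-]; exact: fM.
Qed.

Fact dual_normD (f g : dual) : dual_norm (f + g) <= dual_norm f + dual_norm g.
Proof.
apply: dual_norm_le => x x1; apply: le_trans (ler_normD _ _) _.
by apply: lerD; exact: dual_norm_ge.
Qed.

Fact dual_normZ (a : R) (f : dual) : dual_norm (a *: f) = `|a| * dual_norm f.
Proof.
apply/eqP; rewrite eq_le; apply/andP; split.
  apply: dual_norm_le => x x1; rewrite [leLHS](normrM a (f x)).
  by apply: ler_wpM2l => //; exact: dual_norm_ge.
have [->|a0] := eqVneq a 0.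
  rewrite normr0 mul0r (le_trans (normr_ge0 ((0 *: f) 0)))//.
  by apply: dual_norm_ge; rewrite normr0.
rewrite mulrC -ler_pdivlMr ?normr_gt0//; apply: dual_norm_le => x x1.
rewrite ler_pdivlMr ?normr_gt0// mulrC -(normrM a (f x)).
exact: (@dual_norm_ge (a *: f)).
Qed.

Fact dual_norm0_eq0 (f : dual) : dual_norm f = 0 -> f = 0.
Proof.
move=> f0; apply/val_inj/funext => x /=.
have [->|x0] := eqVneq x 0; first by rewrite [LHS](linear0 f).
have : `|f (`|x|^-1 *: x)| <= 0.
  by rewrite -f0; apply: dual_norm_ge; rewrite normfZV.
rewrite normr_le0 linearZ => /eqP/(congr1 (fun t => `|x| *: t)).
by rewrite /= scalerA mulfV ?normr_eq0// scale1r scaler0.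
Qed.

HB.instance Definition _ :=
  Lmodule_isNormed.Build R dual dual_normD dual_normZ dual_norm0_eq0.

End Dual.

Section Geometry.
Context (R : realType) (X : normedModType R).

Definition reflexive_space : Prop :=
  forall F : dual (dual X), exists x : X, forall f : dual X, F f = f x.

Definition locally_uniformly_convex : Prop :=
  forall (x : X) (e : R), `|x| = 1 -> 0 < e ->
    exists2 d : R, 0 < d & forall y : X,
      `|y| = 1 -> e <= `|x - y| -> `|2^-1 *: (x + y)| <= 1 - d.

Definition frechet_smooth_norm : Prop :=
  forall x : X, x != 0 -> differentiable (fun y : X => `|y| : R^o) x.

Definition duality_map (x : X) : set (dual X) :=
  [set f : dual X | f x = `|x| ^+ 2 /\ `|f| = `|x|].

Definition contingent_cone (Omega : set X) (x : X) : set X :=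
  [set v | exists (t : nat -> R) (w : nat -> X),
    [/\ forall k, 0 < t k, t @ \oo --> (0 : R), w @ \oo --> v
      & forall k, Omega (x + t k *: w k)]].

End Geometry.

Arguments reflexive_space {R} X.
Arguments locally_uniformly_convex {R} X.
Arguments frechet_smooth_norm {R} X.

(* A reflexive Banach space whose given norm is the renorming fixed by the
   standing convention. *)
Definition renormed_reflexive (R : realType) (X : completeNormedModType R) :=
  [/\ reflexive_space X, locally_uniformly_convex X,
      locally_uniformly_convex (dual X) & frechet_smooth_norm X].

Section Product.
Context (R : realType) (X Y : normedModType R).

(* The library norm on X * Y is the max norm (with the same topology). *)
Definition euclid_norm (z : X * Y) : R :=
  Num.sqrt (`|z.1| ^+ 2 + `|z.2| ^+ 2).

Definition pairing (p : dual X * dual Y) (z : X * Y) : R :=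
  p.1 z.1 + p.2 z.2.

(* [limf_esup] is -oo when [zbar] is isolated in [Lambda], so that every [p]
   is then a normal. *)
Definition regular_normal_cone (zbar : X * Y) (Lambda : set (X * Y)) :
    set (dual X * dual Y) :=
  [set p | (limf_esup
     (fun z : X * Y => (pairing p (z - zbar) / euclid_norm (z - zbar))%:E)
     (within Lambda zbar^') <= 0)%E].

Definition local_extremal_point (Lambda1 Lambda2 : set (X * Y))
    (Omega : set X) (zbar : X * Y) : Prop :=
  [/\ (Lambda1 `&` Lambda2) zbar,
      fst @` (Lambda1 `|` Lambda2) `<=` Omega
    & exists (b : nat -> Y) (U : set (X * Y)),
      [/\ b @ \oo --> (0 : Y), nbhs zbar U
        & \forall k \near \oo,
          [set z + (0, b k) | z in Lambda1] `&` Lambda2 `&` U = set0]].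

End Product.

(* Main.v *)
From HB Require Import structures.
Require Import Defs.
From mathcomp Require Import all_boot all_order all_algebra.
From mathcomp Require Import all_classical all_reals all_analysis.
From mathcomp Require Import ring lra.
Set Implicit Arguments.
Unset Strict Implicit.
Unset Printing Implicit Defensive.
Import Order.TTheory GRing.Theory Num.Theory.
Import numFieldNormedType.Exports.
Local Open Scope classical_set_scope.
Local Open Scope ring_scope.

(** Extremality makes phi(z1, z2) = ||z1 - z2 + (0, b_k)|| positive on
    Lambda1 x Lambda2 near zbar, while phi(zbar, zbar) = ||b_k|| is small. The
    Borwein-Preiss principle yields a nearby minimizer (z1, z2) of phi plus a
    smooth penalty with small gradient. With d = z1 - z2 + (0, b_k), the smooth
    norm has gradient J(d)/||d|| of norm 1 at d, so stationarity in each variable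
    separately puts -J(d)/(2||d||) and J(d)/(2||d||), up to small errors, in the
    regular normal cones. The x-component of d is x1 - x2, and convexity of
    Omega makes positive multiples of x2 - x1 and x1 - x2 tangent to Omega
    at x1 and x2. Ekeland's principle would not suffice: its nonsmooth penalty
    only gives eps-normals, which need not lie within eps of the regular
    normal cone. *)

(** * Functionals on a normed space; the duality map as gradient of the squared norm *)

Section DualNorm.
Context (R : realType) (X : normedModType R).

Lemma dual_le_norm (f : dual X) (x : X) : `|f x| <= `|f| * `|x|.
Proof.
have [->|x0] := eqVneq x 0; first by rewrite linear0 !normr0 mulr0.
rewrite -ler_pdivrMr ?normr_gt0//.
have : `|f (`|x|^-1 *: x)| <= `|f| by apply: dual_norm_ge; rewrite normfZV.
by rewrite linearZ [X in X <= _]normrM normfV normr_id mulrC.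
Qed.

Lemma dual_oppE (f : dual X) (x : X) : (- f) x = - f x.
Proof. by []. Qed.

Lemma bounded_dual (f : X -> R) (C : R) : 0 <= C ->
    (forall a x y, f (a *: x + y) = a * f x + f y) ->
    (forall x, `|f x| <= C * `|x|) ->
  exists2 g : dual X, g = f :> (X -> R) & `|g| <= C.
Proof.
move=> C0 flin fC.
have lf : linear (f : X -> R^o) by move=> a x y; exact: flin.
pose fL : {linear X -> R^o} := HB.pack (f : X -> R^o)
  (GRing.isLinear.Build R X R^o _ (f : X -> R^o) lf).
have cf : continuous (f : X -> R^o).
  apply/(@linear_bounded_continuous _ _ _ fL)/bounded_funP => r.
  exists (C * r) => x xr; apply: le_trans (fC x) _; exact: ler_wpM2l.
have fP : (f : X -> R^o) \in @dual_pred R X by rewrite inE; split.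
exists (Dual fP) => //; apply: dual_norm_le => x x1.
by apply: le_trans (fC x) _; rewrite ler_piMr.
Qed.

(** First-order upper expansion of the squared norm with derivative [2 * g]: the side that a
    minimality inequality uses. Squaring also covers the origin, where the norm may fail to be
    differentiable. *)
Definition sq_norm_upper_gradient (x : X) (g : dual X) : Prop :=
  forall e : R, 0 < e -> exists2 d : R, 0 < d & forall h : X, `|h| < d ->
    `|x + h| ^+ 2 <= `|x| ^+ 2 + 2 * g h + e * `|h|.

Lemma sq_norm_upper_gradientN (x : X) (g : dual X) :
  sq_norm_upper_gradient x g -> sq_norm_upper_gradient (- x) (- g).
Proof.
move=> xg e e0; have [d d0 xgd] := xg e e0; exists d => // h hd.
have := xgd (- h); rewrite normrN => /(_ hd).
by rewrite -[`|- x + h|]normrN opprD opprK normrN linearN dual_oppE.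
Qed.

Lemma duality_mapZ (a : R) (x : X) (f : dual X) :
  duality_map x f -> duality_map (a *: x) (a *: f).
Proof.
move=> [fx nf]; split; last by rewrite !normrZ nf.
rewrite (_ : (a *: f) (a *: x) = a * (a * f x)); last first.
  by rewrite -[LHS]/(a * f (a *: x)) linearZ.
by rewrite fx normrZ exprMn real_normK ?num_real//; ring.
Qed.

(** Off the origin, [g] is the norm of [x] times the derivative [D] of the norm. The norm is
    1-Lipschitz, so [D] has norm at most 1, and homogeneity makes [D x] the norm of [x]. *)
Lemma frechet_smooth_duality (x : X) : frechet_smooth_norm X ->
  exists2 g : dual X, duality_map x g & sq_norm_upper_gradient x g.
Proof.
move=> smX; have [->|x0] := eqVneq x 0.
  exists 0; first by split; rewrite ?linear0 !normr0 ?expr0n.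
  move=> e e0; exists e => // h he.
  rewrite add0r normr0 (_ : (0 : dual X) h = 0)// mulr0 expr0n !add0r expr2.
  by rewrite ler_wpM2r// ltW.
have nx0 : 0 < `|x| by rewrite normr_gt0.
have /diff_locallyxC := smX x x0.
set D := 'd _ _ => Dh.
have {Dh} DP (e : R) : 0 < e -> exists2 d : R, 0 < d & forall h : X, `|h| < d ->
    `| `|x + h| - `|x| - D h| <= e * `|h|.
  move=> e0; set o := (X in forall h, _ = _ + X h) in Dh.
  have /nbhs_ballP[d /= d0 od] := littleoP o e0.
  exists d => // h hd; rewrite Dh [_ - D h](_ : _ = o h); last by ring.
  by apply: od; rewrite -ball_normE /= sub0r normrN.
have scale_small (d : R) (h : X) : 0 < d -> exists2 t : R, 0 < t & `|t *: h| < d.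
  move=> d0; have h1 : 0 < `|h| + 1 by rewrite ltr_wpDl.
  exists (d / (`|h| + 1)); first exact: divr_gt0.
  rewrite normrZ gtr0_norm ?divr_gt0// mulrAC ltr_pdivrMr//.
  by rewrite ltr_pM2l// ltrDl.
have DZ t h : D (t *: h) = t * D h by rewrite linearZ.
(* Both facts about [D] follow by expanding along [t *: h] for one small [t] and dividing by [t]. *)
have Dle h : `|D h| <= `|h|.
  apply/ler_addgt0Pr => e e0.
  have h1 : 0 < `|h| + 1 by rewrite ltr_wpDl.
  have [d d0 Dd] := DP (e / (`|h| + 1)) (divr_gt0 e0 h1).
  have [t t0 th] := scale_small d h d0.
  have := Dd _ th; rewrite DZ normrZ (gtr0_norm t0) => Dt.
  have := ler_dist_dist (x + t *: h) x.
  rewrite addrAC subrr add0r normrZ (gtr0_norm t0) => nt.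
  have eh : e / (`|h| + 1) * `|h| <= e.
    by rewrite mulrAC ler_pdivrMr// ler_pM2l// lerDl.
  have : `|t * D h| <= t * (`|h| + e).
    have -> : t * D h = `|x + t *: h| - `|x| - (`|x + t *: h| - `|x| - t * D h) by ring.
    apply: le_trans (ler_normB _ _) _; rewrite mulrDr; apply: lerD => //.
    by apply: le_trans Dt _; rewrite mulrCA ler_pM2l.
  by rewrite normrM (gtr0_norm t0) ler_pM2l.
have Dx : D x = `|x|.
  apply/eqP; rewrite eq_sym -subr_eq0 -normr_le0; apply/ler_addgt0Pr => e e0.
  rewrite add0r.
  have [d d0 Dd] := DP (e / `|x|) (divr_gt0 e0 nx0).
  have [t t0 tx] := scale_small d x d0.
  have xt : x + t *: x = (1 + t) *: x by rewrite scalerDl scale1r.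
  have := Dd _ tx; rewrite DZ xt !normrZ.
  rewrite (gtr0_norm t0) gtr0_norm ?addr_gt0//.
  have -> : (1 + t) * `|x| - `|x| - t * D x = t * (`|x| - D x) by ring.
  by rewrite normrM (gtr0_norm t0) mulrCA ler_pM2l// divfK// gt_eqF.
have [||g gE gle] := @bounded_dual (fun h => `|x| * D h) `|x| (normr_ge0 x).
- by move=> a u v; rewrite linearD DZ mulrDr mulrCA.
- by move=> h; rewrite normrM normr_id ler_wpM2l.
have gEx h : g h = `|x| * D h by rewrite gE.
exists g.
  split; first by rewrite gEx Dx.
  apply/eqP; rewrite eq_le gle /=.
  have := dual_le_norm g x; rewrite gEx Dx normrM normr_id.
  by rewrite ler_pM2r.
(* The square is expanded exactly around the norm of [x]: the cross term and the squared increment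
   each get half of [e]. *)
move=> e e0; have e0' : 0 < e / 4 / `|x| by rewrite !divr_gt0.
have [d d0 Dd] := DP _ e0'.
exists (Num.min d (e / 2)); first by rewrite lt_min d0 divr_gt0.
move=> h; rewrite lt_min => /andP[hd he].
have := Dd _ hd => /(le_trans (ler_norm _)) Dh1.
have := ler_dist_dist (x + h) x; rewrite addrAC subrr add0r => nh.
have {}nh : (`|x + h| - `|x|) ^+ 2 <= `|h| * (e / 2).
  rewrite -real_normK ?num_real// expr2; apply: ler_pM => //.
  exact: le_trans nh (ltW he).
have {}Dh1 : 2 * `|x| * (`|x + h| - `|x| - D h) <= e / 2 * `|h|.
  have -> : e / 2 * `|h| = 2 * `|x| * (e / 4 / `|x| * `|h|).
    by field; rewrite gt_eqF.
  by rewrite ler_pM2l// mulr_gt0.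
have -> : `|x + h| ^+ 2 = `|x| ^+ 2 + 2 * `|x| * D h
  + 2 * `|x| * (`|x + h| - `|x| - D h) + (`|x + h| - `|x|) ^+ 2 by ring.
rewrite gEx; nra.
Qed.

End DualNorm.

(** * Dyadic weights and their tails *)

Section DyadicWeights.
Context (R : realType).

(** The exponent [i.+1] makes the total weight 1, so weighted sums keep the uniform bounds of their
    terms. *)
Definition dyadic_weight (i : nat) : R := 2^-1 ^+ i.+1.

Lemma dyadic_weight_gt0 i : 0 < dyadic_weight i.
Proof. by rewrite exprn_gt0// invr_gt0. Qed.

Lemma sum_dyadic_weight (m n : nat) : (m <= n)%N ->
  \sum_(m <= i < n) dyadic_weight i = 2^-1 ^+ m - 2^-1 ^+ n.
Proof.
move=> mn; rewrite (eq_bigr (fun i => (- 2^-1 ^+ i.+1) - (- 2^-1 ^+ i))).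
  by rewrite telescope_sumr//; ring.
by move=> i _; rewrite /dyadic_weight exprS; field.
Qed.

Lemma sum_dyadic_weight_le (m n : nat) : (m <= n)%N ->
  \sum_(m <= i < n) dyadic_weight i <= 2^-1 ^+ m.
Proof.
by move=> mn; rewrite sum_dyadic_weight// gerBl exprn_ge0// invr_ge0.
Qed.

Lemma dyadic_small (K e : R) : 0 < e ->
  exists N : nat, forall n, (N <= n)%N -> K * 2^-1 ^+ n < e.
Proof.
move=> e0; have h1 : `|2^-1 : R| < 1 by rewrite gtr0_norm ?invr_gt0// invf_lt1// ltr1n.
have /cvgr0Pnorm_lt/(_ _ e0)[N _ NP] := cvg_geometric K h1.
exists N => n Nn; apply: le_lt_trans (NP n Nn); exact: ler_norm.
Qed.

End DyadicWeights.

(** * First-order estimates for dyadic series of squared norms *)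

Section DyadicPenalty.
Context (R : realType) (X : normedModType R).

(** [G] is the pointwise sum of the weighted series, which converges absolutely; the error term
    bounds its tail, since the weights from [N] on sum to [2^-1 ^+ N]. *)
Lemma dyadic_dual_series (g : nat -> dual X) (C : R) : (forall i, `|g i| <= C) ->
  exists2 G : dual X, `|G| <= C & forall (N : nat) (h : X),
    \sum_(0 <= i < N) dyadic_weight R i * g i h <= G h + C * 2^-1 ^+ N * `|h|.
Proof.
move=> gC; have C0 : 0 <= C by exact: le_trans (normr_ge0 _) (gC 0%N).
pose u h i : R := dyadic_weight R i * g i h.
have ule h i : `|u h i| <= C * `|h| * dyadic_weight R i.
  rewrite normrM gtr0_norm ?dyadic_weight_gt0// mulrC ler_wpM2r//.
    exact/ltW/dyadic_weight_gt0.
  by apply: le_trans (dual_le_norm _ _) _; rewrite ler_wpM2r.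
have h1 : `|2^-1 : R| < 1 by rewrite gtr0_norm ?invr_gt0// invf_lt1// ltr1n.
have ucvg h : cvgn (series (u h)).
  apply: normed_cvg; apply: (@series_le_cvg _ _ (geometric (C * `|h| / 2) 2^-1)).
  - by move=> n; exact: normr_ge0.
  - by move=> n; rewrite /geometric /= !mulr_ge0 ?exprn_ge0 ?invr_ge0.
  - move=> n; apply: le_trans (ule h n) _.
    by rewrite /geometric /= /dyadic_weight exprS mulrA.
  - exact: is_cvg_geometric_series.
have tail h m n : (m <= n)%N ->
    `|\sum_(m <= i < n) u h i| <= C * 2^-1 ^+ m * `|h|.
  move=> mn; apply: le_trans (ler_norm_sum _ _ _) _.
  apply: (@le_trans _ _ (\sum_(m <= i < n) C * `|h| * dyadic_weight R i)).
    by apply: ler_sum => i _; exact: ule.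
  rewrite -mulr_sumr mulrAC ler_wpM2r// ?ler_wpM2l//.
  exact: sum_dyadic_weight_le.
have [||G GE GC] := @bounded_dual _ _ (fun h => limn (series (u h))) C C0.
- move=> a x y; have -> : series (u (a *: x + y)) = a *: series (u x) + series (u y).
    apply/funext => n; rewrite /series /= !fctE /= scaler_sumr -big_split /=.
    apply: eq_bigr => i _.
    rewrite /u (_ : g i (a *: x + y) = a * g i x + g i y); last first.
      exact: dual_is_linear.
    by rewrite -[X in _ = X + _]/(a * (dyadic_weight R i * g i x)); ring.
  have xc : cvgn (a *: series (u x)) by apply: is_cvgZl_tmp; exact: ucvg.
  by rewrite (limD xc (ucvg y)) (@limZl_tmp _ _ _ _ _ a _ (ucvg x)).
- move=> h; have Lc : `|series (u h) n| @[n --> \oo] --> `|limn (series (u h))|.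
    by apply: cvg_norm; exact: ucvg.
  rewrite -(cvg_lim _ Lc)//; apply: limr_le.
    by apply/cvg_ex; eexists; exact: Lc.
  by apply: nearW => n; have := tail h 0%N n (leq0n _); rewrite expr0 mulr1.
exists G => // N h; rewrite GE.
rewrite -lerBlDr; apply: limr_ge; first exact: ucvg.
exists N => // n /= Nn; rewrite /series /= (big_cat_nat (leq0n _) Nn) /=.
have := tail h _ _ Nn; rewrite ler_norml => /andP[+ _].
by rewrite /u; lra.
Qed.

(** With [a i = z - w i], this is the change of the weighted sum of squared distances to the [w i]
    when [z] moves by [h]. *)
Definition dyadic_penalty (a : nat -> X) (n : nat) (h : X) : R :=
  \sum_(0 <= i < n) dyadic_weight R i * (`|a i + h| ^+ 2 - `|a i| ^+ 2).

(** The first [N] terms share a radius on which their gradient expansions hold; the remaining terms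
    are uniformly Lipschitz in [h] and have small total weight. *)
Lemma dyadic_penalty_upper (a : nat -> X) (C : R) :
    frechet_smooth_norm X -> (forall i, `|a i| <= C) ->
  exists2 G : dual X, `|G| <= C & forall e : R, 0 < e ->
    exists (d : R) (N : nat), 0 < d /\ forall h : X, `|h| < d ->
      forall n, (N <= n)%N -> dyadic_penalty a n h <= 2 * G h + e * `|h|.
Proof.
move=> smX aC; have C0 : 0 <= C by exact: le_trans (normr_ge0 _) (aC 0%N).
have /choice[g gP] : forall i, exists g : dual X,
    duality_map (a i) g /\ sq_norm_upper_gradient (a i) g.
  by move=> i; have [g] := frechet_smooth_duality (a i) smX; exists g.
have [|G GC GP] := @dyadic_dual_series g C.
  by move=> i; have [[_ ->] _] := gP i.
exists G => // e e0.
(* Of [4 * C + 1], the part [2 * C] pays for truncating [2 * G], and [2 * C + 1] is the Lipschitz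
   constant of the tail terms for [h] of norm below 1. *)
have [N NP] := dyadic_small (4 * C + 1) (divr_gt0 e0 (ltr0n R 2)).
have [d d0 dP] : exists2 d : R, 0 < d & forall i, (i < N)%N ->
    forall h : X, `|h| < d -> `|a i + h| ^+ 2 - `|a i| ^+ 2 <= 2 * g i h + e / 2 * `|h|.
  elim: (N) => [|k [d d0 dP]]; first by exists 1.
  have [d' d'0 d'P] := (gP k).2 _ (divr_gt0 e0 (ltr0n R 2)).
  exists (Num.min d d'); first by rewrite lt_min d0.
  move=> i; rewrite ltnS leq_eqVlt => /orP[/eqP-> h|ik h].
    by rewrite lt_min => /andP[_ /d'P]; lra.
  by rewrite lt_min => /andP[/(dP _ ik)].
exists (Num.min d 1), N; split; first by rewrite lt_min d0 /=.
move=> h; rewrite lt_min => /andP[hd h1] n Nn.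
have tail i : `|a i + h| ^+ 2 - `|a i| ^+ 2 <= (2 * C + 1) * `|h|.
  have := aC i; have := ler_normD (a i) h; have := normr_ge0 (a i + h).
  have := normr_ge0 (a i); have := normr_ge0 h; nra.
rewrite /dyadic_penalty (big_cat_nat (leq0n _) Nn) /=.
have H1 : \sum_(0 <= i < N) dyadic_weight R i * (`|a i + h| ^+ 2 - `|a i| ^+ 2) <=
    2 * (G h + C * 2^-1 ^+ N * `|h|) + e / 2 * `|h|.
  apply: (@le_trans _ _ (\sum_(0 <= i < N)
     (2 * (dyadic_weight R i * g i h) + dyadic_weight R i * (e / 2 * `|h|)))).
    rewrite !big_mkord; apply: ler_sum => i _.
    rewrite mulrCA -mulrDr ler_wpM2l//; first exact/ltW/dyadic_weight_gt0.
    exact: dP.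
  rewrite big_split /= -mulr_sumr -mulr_suml; apply: lerD.
    by rewrite ler_pM2l.
  rewrite ler_piMl//; first by rewrite !mulr_ge0 ?invr_ge0// ltW.
  by have := sum_dyadic_weight_le R (leq0n N); rewrite expr0.
have H2 : \sum_(N <= i < n) dyadic_weight R i * (`|a i + h| ^+ 2 - `|a i| ^+ 2) <=
    2^-1 ^+ N * ((2 * C + 1) * `|h|).
  apply: (@le_trans _ _ (\sum_(N <= i < n) dyadic_weight R i * ((2 * C + 1) * `|h|))).
    apply: ler_sum => i _; rewrite ler_wpM2l//; exact/ltW/dyadic_weight_gt0.
  rewrite -mulr_suml ler_wpM2r//; last exact: sum_dyadic_weight_le.
  by rewrite mulr_ge0// addr_ge0// mulr_ge0.
have H3 : (4 * C + 1) * 2^-1 ^+ N * `|h| <= e / 2 * `|h|.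
  by rewrite ler_wpM2r// ltW// NP.
by lra.
Qed.

End DyadicPenalty.

(** * The Euclidean product norm and a criterion for regular normals *)

Section EuclidNorm.
Context (R : realType) (X Y : normedModType R).
Implicit Types z h : X * Y.

Lemma euclid_norm_sq z : euclid_norm z ^+ 2 = `|z.1| ^+ 2 + `|z.2| ^+ 2.
Proof. by rewrite sqr_sqrtr// addr_ge0. Qed.

Lemma euclid_norm_ge0 z : 0 <= euclid_norm z.
Proof. exact: sqrtr_ge0. Qed.

Lemma fst_le_euclid_norm z : `|z.1| <= euclid_norm z.
Proof.
by rewrite -(@ler_pXn2r _ 2)// ?nnegrE ?euclid_norm_ge0// euclid_norm_sq lerDl.
Qed.

Lemma snd_le_euclid_norm z : `|z.2| <= euclid_norm z.
Proof.
by rewrite -(@ler_pXn2r _ 2)// ?nnegrE ?euclid_norm_ge0// euclid_norm_sq lerDr.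
Qed.

Lemma euclid_norm_eq0 z : euclid_norm z = 0 -> z = 0.
Proof.
move=> z0; have := fst_le_euclid_norm z; have := snd_le_euclid_norm z.
by rewrite z0 !normr_le0 => /eqP z20 /eqP z10; rewrite [z]surjective_pairing z10 z20.
Qed.

Lemma norm_le_euclid_norm z : `|z| <= euclid_norm z.
Proof.
by rewrite prod_normE ge_max fst_le_euclid_norm snd_le_euclid_norm.
Qed.

Lemma regular_normal_cone_le (z : X * Y) (Lambda : set (X * Y))
    (p : dual X * dual Y) :
    (forall e : R, 0 < e -> exists2 d : R, 0 < d & forall h, Lambda (z + h) ->
      `|h| < d -> pairing p h <= e * (`|h.1| + `|h.2|)) ->
  regular_normal_cone z Lambda p.
Proof.
move=> pP; apply/lee_addgt0Pr => e e0; rewrite add0e.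
have [d d0 dP] := pP (e / 2) (divr_gt0 e0 (ltr0n R 2)).
(* The upper limit is an infimum of suprema over the members of the filter, so the single member [V]
   bounds it. *)
pose V := [set u | [/\ `|u - z| < d, u != z & Lambda u]].
apply: ereal_inf_le.
exists (ereal_sup [set (pairing p (u - z) / euclid_norm (u - z))%:E | u in V]).
  exists V => //; change (\forall u \near z, u != z -> Lambda u -> V u).
  apply/nbhs_normP; exists d => // u /= ud uz Lu; split => //.
  by rewrite distrC.
apply: ge_ereal_sup => _ [u [ud uz Lu] <-]; rewrite lee_fin.
have u0 : 0 < euclid_norm (u - z).
  rewrite lt_neqAle euclid_norm_ge0 andbT eq_sym.
  by apply: contra uz => /eqP/euclid_norm_eq0/eqP; rewrite subr_eq0.
rewrite ler_pdivrMr//; apply: (@le_trans _ _ (e / 2 * (`|(u - z).1| + `|(u - z).2|))).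
  by apply: dP => //; rewrite addrC subrK.
have -> : e * euclid_norm (u - z) = e / 2 * (euclid_norm (u - z) + euclid_norm (u - z)).
  by field.
rewrite ler_pM2l ?divr_gt0//.
by apply: lerD; [exact: fst_le_euclid_norm | exact: snd_le_euclid_norm].
Qed.

End EuclidNorm.

(** * Regular normals from minima of a penalized distance *)

Section PenalizedDistance.
Context (R : realType) (X Y : normedModType R).

(* A square root lies below its tangent line, so upper estimates on squared
   norms give upper estimates on the euclidean distance. *)
Lemma le_add_sq_div (s t : R) : 0 < s -> t <= s + (t ^+ 2 - s ^+ 2) / (2 * s).
Proof.
move=> s0; rewrite -subr_ge0.
have -> : s + (t ^+ 2 - s ^+ 2) / (2 * s) - t = (t - s) ^+ 2 / (2 * s).
  by field; rewrite gt_eqF.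
by rewrite divr_ge0 ?sqr_ge0// mulr_ge0// ltW.
Qed.

(** At a minimum the negative gradient is a regular normal. The distance contributes [(gx, gy)] over
    its value, the penalty [2 * m] times its dual series. Halving all of this gives the stated
    normal and the error bound [m * C]. *)
Lemma regular_normal_of_penalized_min (Lambda : set (X * Y)) (z c : X * Y)
    (gx : dual X) (gy : dual Y) (a : nat -> X * Y) (C m r : R) :
    frechet_smooth_norm X -> frechet_smooth_norm Y ->
    sq_norm_upper_gradient (z - c).1 gx -> sq_norm_upper_gradient (z - c).2 gy ->
    0 < euclid_norm (z - c) -> (forall i, `|a i| <= C) -> 0 < m -> 0 < r ->
    (forall h, Lambda (z + h) -> `|h| < r ->
      exists M, forall n, (M <= n)%N ->
        euclid_norm (z - c) <= euclid_norm (z + h - c) +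
          m * (dyadic_penalty (fst \o a) n h.1 + dyadic_penalty (snd \o a) n h.2)) ->
  exists q : dual X * dual Y, [/\ `|q.1| <= m * C, `|q.2| <= m * C &
    regular_normal_cone z Lambda
      (- ((2 * euclid_norm (z - c))^-1 *: gx) - q.1,
       - ((2 * euclid_norm (z - c))^-1 *: gy) - q.2)].
Proof.
move=> smX smY gxP gyP; set phi := euclid_norm (z - c) => phi0 aC m0 r0 zmin.
have aC1 i : `|(fst \o a) i| <= C.
  by apply: le_trans (aC i); rewrite prod_normE /= le_max lexx.
have aC2 i : `|(snd \o a) i| <= C.
  by apply: le_trans (aC i); rewrite prod_normE /= le_max lexx orbT.
have [Gx GxC GxP] := dyadic_penalty_upper smX aC1.
have [Gy GyC GyP] := dyadic_penalty_upper smY aC2.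
exists (m *: Gx, m *: Gy); split => /=; rewrite ?normrZ ?(gtr0_norm m0) ?ler_pM2l//.
apply: regular_normal_cone_le => e e0.
set k := (2 * phi)^-1; have k0 : 0 < k by rewrite invr_gt0 mulr_gt0.
(* The errors add up to [(k + m) * e1 = 2 * e], and the final division by 2 leaves [e]. *)
pose e1 := 2 * e / (k + m); have e10 : 0 < e1 by rewrite divr_gt0 ?mulr_gt0 ?addr_gt0.
have [d1 d10 d1P] := gxP _ e10; have [d2 d20 d2P] := gyP _ e10.
have [d3 [N3 [d30 d3P]]] := GxP _ e10; have [d4 [N4 [d40 d4P]]] := GyP _ e10.
exists (Num.min r (Num.min (Num.min d1 d2) (Num.min d3 d4))).
  by rewrite !lt_min r0 d10 d20 d30 d40.
move=> h Lh; rewrite lt_min => /andP[hr].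
rewrite [`|h| in X in X -> _]prod_normE gt_max !lt_min.
move=> /andP[/andP[/andP[h1 _] /andP[h3 _]] /andP[/andP[_ h2] /andP[_ h4]]].
have [M MP] := zmin h Lh hr.
pose n := maxn M (maxn N3 N4).
have := MP n (leq_maxl _ _).
have := d3P _ h3 n (leq_trans (leq_maxl _ _) (leq_maxr _ _)).
have := d4P _ h4 n (leq_trans (leq_maxr _ _) (leq_maxr _ _)).
have := d1P _ h1; have := d2P _ h2.
have := le_add_sq_div (euclid_norm (z + h - c)) phi0; rewrite [_ / (2 * phi)]mulrC -/k.
rewrite (euclid_norm_sq (z + h - c)) [phi ^+ 2]euclid_norm_sq.
have -> : (z + h - c).1 = (z - c).1 + h.1 by rewrite /= addrAC.
have -> : (z + h - c).2 = (z - c).2 + h.2 by rewrite /= addrAC.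
set P1 := dyadic_penalty _ _ _; set P2 := dyadic_penalty _ _ _.
set S1 := `|_ + _| ^+ 2; set S2 := `|_ + _| ^+ 2.
set T1 := `|(z - c).1| ^+ 2; set T2 := `|(z - c).2| ^+ 2.
move=> Hphi HS2 HS1 HP2 HP1 Hmin.
rewrite [pairing _ _](_ : _ =
  - (k * gx h.1) - m * Gx h.1 + (- (k * gy h.2) - m * Gy h.2)) //.
have Hk : k * (S1 + S2 - (T1 + T2)) <=
    k * (2 * gx h.1 + 2 * gy h.2 + e1 * (`|h.1| + `|h.2|)).
  by rewrite ler_pM2l//; lra.
have Hm : m * (P2 + P1) <= m * (2 * Gx h.1 + 2 * Gy h.2 + e1 * (`|h.1| + `|h.2|)).
  by rewrite ler_pM2l//; lra.
have He : k * (e1 * (`|h.1| + `|h.2|)) + m * (e1 * (`|h.1| + `|h.2|)) =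
    2 * (e * (`|h.1| + `|h.2|)).
  by rewrite /e1; field; rewrite gt_eqF// addr_gt0.
have := le_trans Hmin (lerD Hphi Hm).
move: Hk He; clear -R; lra.
Qed.

End PenalizedDistance.

(** * Completeness of products and the smooth variational principle *)

Section SmoothVariationalPrinciple.
Context (R : realType).

Definition cauchy_complete (T : normedModType R) : Prop :=
  forall u : nat -> T, cauchy (u @ \oo) -> exists l : T, u @ \oo --> l.

Lemma banach_cauchy_complete (T : completeNormedModType R) : cauchy_complete T.
Proof. by move=> u /cauchy_cvg/cvg_ex. Qed.

Lemma prod_cauchy_complete (T U : normedModType R) :
  cauchy_complete T -> cauchy_complete U ->
  cauchy_complete (T * U)%type.
Proof.
move=> cT cU u /cauchyP uc.
have [|a ua] := cT (fst \o u).
  apply/cauchyP => e e0; have [x xu] := uc e e0; exists x.1.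
  have {}xu : \forall n \near \oo, ball x e (u n) by exact: xu.
  by apply: filterS xu => n; case.
have [|b ub] := cU (snd \o u).
  apply/cauchyP => e e0; have [x xu] := uc e e0; exists x.2.
  have {}xu : \forall n \near \oo, ball x e (u n) by exact: xu.
  by apply: filterS xu => n; case.
exists (a, b); rewrite [u](_ : _ = fun n => ((fst \o u) n, (snd \o u) n)).
  exact: cvg_pair.
by apply/funext => n; exact: surjective_pairing.
Qed.

(** The state holds the penalized function, the current sublevel set and the current centre. The
    next centre is an approximate minimizer on the new set; [w] is only the default of [xget]. *)
Fixpoint descent (T : normedModType R) (rho : T -> T -> R) (mu eps : nat -> R)
    (f : T -> R) (S : set T) (w0 : T) (n : nat) : (T -> R) * set T * T :=
  if n is k.+1 then
    let: (F, A, w) := descent rho mu eps f S w0 k in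
    let F' := fun u => F u + mu k * rho u w in
    let A' := [set u | A u /\ F' u <= F w] in
    (F', A', xget w [set v | A' v /\
      forall u, A' u -> F' v <= F' u + eps k.+1])
  else (f, S, w0).

(* The Borwein-Preiss principle: the minimized function differs from f by a
   series of multiples of rho ^~ (w i), which is smooth whenever rho is; the
   inequality is stated for the partial sums. *)
Lemma smooth_variational_principle (T : normedModType R) (rho : T -> T -> R)
    (f : T -> R) (S : set T) (w0 : T) (m e0 : R) :
    cauchy_complete T -> closed S -> continuous f ->
    (forall v, continuous (rho ^~ v)) -> (forall v, rho v v = 0) ->
    (forall u v, `|u - v| ^+ 2 <= rho u v) ->
    0 < m -> 0 < e0 -> S w0 -> (forall u, S u -> f w0 <= f u + e0) ->
  exists (w : nat -> T) (wbar : T),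
    [/\ w 0%N = w0, S wbar, forall i, rho wbar (w i) <= 2 * e0 / m &
      forall u, S u -> exists M, forall n, (M <= n)%N ->
        f wbar + m * \sum_(0 <= i < n) dyadic_weight R i * rho wbar (w i) <=
        f u + m * \sum_(0 <= i < n) dyadic_weight R i * rho u (w i)].
Proof.
move=> cT clS cf crho rho0 rho_ge m0 e00 Sw0 w0min.
pose mu i : R := m * dyadic_weight R i.
have mu0 i : 0 < mu i by rewrite mulr_gt0// dyadic_weight_gt0.
pose c : R := 2 * e0 / m.
have c0 : 0 < c by rewrite divr_gt0// mulr_gt0.
(* Chosen so that [eps 0 = e0], and so that dividing the slack [eps n] by the weight [mu n] leaves
   the geometric bound [c * 2^-1 ^+ n]. *)
pose eps i : R := c * 2^-1 ^+ i * mu i.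
have eps0 i : 0 < eps i by rewrite mulr_gt0// mulr_gt0// exprn_gt0 ?invr_gt0.
pose st := descent rho mu eps f S w0.
pose F n := (st n).1.1; pose A n := (st n).1.2; pose w n := (st n).2.
have FS n u : F n.+1 u = F n u + mu n * rho u (w n).
  by rewrite /F /w /st /=; case: (descent _ _ _ _ _ _ _) => [[? ?] ?].
have AS n : A n.+1 = [set u | A n u /\ F n.+1 u <= F n (w n)].
  by rewrite /A /F /w /st /=; case: (descent _ _ _ _ _ _ _) => [[? ?] ?].
have wS n : w n.+1 = xget (w n) [set v | A n.+1 v /\
    forall u, A n.+1 u -> F n.+1 v <= F n.+1 u + eps n.+1].
  by rewrite /A /F /w /st /=; case: (descent _ _ _ _ _ _ _) => [[? ?] ?].
have rho_ge0 u v : 0 <= rho u v by apply: le_trans (rho_ge u v); rewrite sqr_ge0.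
have inv n : A n (w n) /\ forall u, A n u -> F n (w n) <= F n u + eps n.
  elim: n => [|n [Aw wmin]].
    split => // u Su; suff -> : eps 0%N = e0 by exact: w0min.
    by rewrite /eps /c /mu /dyadic_weight expr0 expr1; field; rewrite gt_eqF.
  (* An approximate minimizer exists, so [xget] never returns its default: the new set contains
     [w n], and [F n.+1] is bounded below on it. *)
  suff : exists v, A n.+1 v /\ forall u, A n.+1 u -> F n.+1 v <= F n.+1 u + eps n.+1.
    by move=> /(xgetPex (w n)); rewrite -wS.
  have AnSw : A n.+1 (w n) by rewrite AS; split => //; rewrite FS rho0 mulr0 addr0.
  have hi : has_inf [set F n.+1 u | u in A n.+1].
    split; first by exists (F n.+1 (w n)), (w n).
    exists (F n (w n) - eps n) => _ [u + <-]; rewrite AS => -[Anu _].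
    rewrite lerBlDr; apply: le_trans (wmin u Anu) _.
    by rewrite lerD2r FS lerDl mulr_ge0// ltW.
  have [_ [v Av <-] vlt] := inf_adherent (eps0 n.+1) hi.
  exists v; split => // u Au; apply: le_trans (ltW vlt) _.
  by rewrite lerD2r; apply: ge_inf; [exact: hi.2|exists u].
(* Such a [u] satisfies [F n u + mu n * rho u (w n) <= F n (w n) <= F n u + eps n]. *)
have AP n u : A n.+1 u -> rho u (w n) <= c * 2^-1 ^+ n.
  rewrite AS => -[Anu]; rewrite FS => Fu; have := (inv n).2 u Anu.
  move=> Fw; have : mu n * rho u (w n) <= mu n * (c * 2^-1 ^+ n).
    by rewrite [leRHS]mulrC -/(eps n); lra.
  by rewrite ler_pM2l.
have Asub n k : (n <= k)%N -> A k `<=` A n.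
  elim: k => [|k IHk]; first by rewrite leqn0 => /eqP->.
  rewrite leq_eqVlt => /orP[/eqP->//|]; rewrite ltnS => /IHk nk.
  by apply: subset_trans nk; rewrite AS => u [].
have near_w e : 0 < e ->
    exists N, forall n, (N <= n)%N -> forall u, A n.+1 u -> `|u - w n| < e.
  move=> ep; have [N NP] := dyadic_small c (exprn_gt0 2 ep).
  exists N => n Nn u /AP uw.
  rewrite -(@ltr_pXn2r _ 2)// ?nnegrE ?(ltW ep)//.
  by apply: le_lt_trans (rho_ge _ _) _; apply: le_lt_trans uw _; exact: NP.
have Fcont : forall n, continuous (F n).
  elim=> [//|n IHn] x.
  rewrite (_ : F n.+1 = fun u => F n u + mu n * rho u (w n)); last first.
    by apply/funext => u; exact: FS.
  by apply: cvgD; [exact: IHn|apply: cvgMr; exact: crho].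
have Aclosed n : closed (A n).
  elim: n => [//|n IHn]; rewrite AS; apply: closedI => //.
  apply: (@preimage_closed _ _ (F n.+1) [set x | x <= F n (w n)]).
    by move=> x _; exact: Fcont.
  exact: closed_le.
have [wbar wwbar] : exists l : T, w @ \oo --> l.
  apply: cT; apply/cauchyP => e ep; have [N NP] := near_w e ep.
  exists (w N); exists N.+1 => // n /= Nn.
  rewrite -ball_normE /= distrC; apply: NP => //.
  exact: (Asub _ _ Nn _ (inv n).1).
have Awbar n : A n wbar.
  apply: (@closed_cvg _ _ _ _ w (A n) (Aclosed n) _ wbar wwbar).
  exists n => // k /= nk; exact: (Asub _ _ nk _ (inv k).1).
have FE n u : F n u = f u + m * \sum_(0 <= i < n) dyadic_weight R i * rho u (w i).
  elim: n => [|n IHn]; first by rewrite big_geq// mulr0 addr0.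
  by rewrite FS IHn big_nat_recr //= mulrDr mulrA addrA.
exists w, wbar; split => //.
- exact: (Awbar 0%N).
- move=> i; apply: le_trans (AP i _ (Awbar i.+1)) _.
  by rewrite ler_piMr ?(ltW c0)// exprn_ile1 ?invr_ge0// invf_le1// ler1n.
(* The sets [A n] shrink to [wbar], so a point in all of them is [wbar]. Any other [u] drops out at
   some stage [k], where [F k.+1 u] exceeds [F k (w k)]; this persists because [F n u] increases
   with [n] while [F n (w n)] decreases. *)
move=> u Su; have [Au|] := pselect (forall n, A n u).
  suff -> : u = wbar by exists 0%N.
  apply/eqP; rewrite -subr_eq0 -normr_le0; apply/ler_addgt0Pr => e ep.
  have [N NP] := near_w _ (divr_gt0 ep (ltr0n R 2)).
  have := NP N (leqnn N) _ (Au N.+1); have := NP N (leqnn N) _ (Awbar N.+1).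
  have := ler_distD (w N) u wbar; rewrite [`|w N - _|]distrC; lra.
move=> /existsNP[N ANu].
have [k Aku ASku] : exists2 k, A k u & ~ A k.+1 u.
  elim: N ANu => [//|N IHN] ANu; have [ANu'|/IHN//] := pselect (A N u).
  by exists N.
exists k.+1 => n kn; rewrite -!FE.
have v_noninc i j : (i <= j)%N -> F j (w j) <= F i (w i).
  elim: j => [|j IHj]; first by rewrite leqn0 => /eqP->.
  rewrite leq_eqVlt => /orP[/eqP->//|]; rewrite ltnS => /IHj; apply: le_trans.
  by have := (inv j.+1).1; rewrite AS => -[].
have F_nondec i j : (i <= j)%N -> F i u <= F j u.
  elim: j => [|j IHj]; first by rewrite leqn0 => /eqP->.
  rewrite leq_eqVlt => /orP[/eqP->//|]; rewrite ltnS => /IHj/le_trans; apply.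
  by rewrite FS lerDl mulr_ge0// ltW.
case: n kn => // n kn.
have := Awbar n.+1; rewrite AS => -[_ Fwbar]; apply: (le_trans Fwbar).
apply: le_trans (v_noninc k n kn) _; apply: le_trans (F_nondec k.+1 n.+1 kn).
by rewrite leNgt; apply/negP => Fk; apply: ASku; rewrite AS; split => //; exact: ltW.
Qed.

End SmoothVariationalPrinciple.

(** * Continuity of the Euclidean distance, increments of the penalty, tangent directions *)

Section EuclidNormContinuity.
Context (R : realType) (X Y : normedModType R).

Lemma euclid_norm_continuous : continuous (@euclid_norm R X Y).
Proof.
move=> z; apply: (@continuous_comp _ _ _
  (fun z : X * Y => `|z.1| ^+ 2 + `|z.2| ^+ 2) Num.sqrt); last exact: sqrt_continuous.
by apply: cvgD; apply: cvgM; apply: cvg_norm; (exact: cvg_fst || exact: cvg_snd).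
Qed.

Lemma euclid_dist_sq_continuous (c : X * Y) :
  continuous (fun z : X * Y => euclid_norm (z - c) ^+ 2).
Proof.
move=> z; apply: (@continuous_comp _ _ _ (fun z : X * Y => z - c)
  (fun z => euclid_norm z ^+ 2)).
  by apply: cvgB; [exact: cvg_id | exact: cvg_cst].
by apply: cvgM; exact: euclid_norm_continuous.
Qed.

Lemma euclid_normN (z : X * Y) : euclid_norm (- z) = euclid_norm z.
Proof. by rewrite /euclid_norm /= !normrN. Qed.

Lemma euclid_normZ (k : R) (z : X * Y) : euclid_norm (k *: z) = `|k| * euclid_norm z.
Proof.
rewrite /euclid_norm /= !normrZ !exprMn -mulrDr sqrtrM ?sqr_ge0//.
by rewrite sqrtr_sqr normr_id.
Qed.

(** Here [g i] is the penalty of the variable held fixed; it cancels between the two sides. *)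
Lemma penalized_increment (z h : X * Y) (w : nat -> X * Y) (s t : R)
    (g : nat -> R) (n : nat) :
    s + \sum_(0 <= i < n) dyadic_weight R i *
      (euclid_norm (z - w i) ^+ 2 + g i) <=
    t + \sum_(0 <= i < n) dyadic_weight R i *
      (euclid_norm (z + h - w i) ^+ 2 + g i) ->
  s <= t + (dyadic_penalty (fst \o (fun i => z - w i)) n h.1 +
            dyadic_penalty (snd \o (fun i => z - w i)) n h.2).
Proof.
rewrite -lerBrDr -addrA -sumrB.
rewrite (_ : \sum_(0 <= i < n) _ =
    dyadic_penalty (fst \o (fun i => z - w i)) n h.1 +
    dyadic_penalty (snd \o (fun i => z - w i)) n h.2)//.
rewrite /dyadic_penalty -big_split /=; apply: eq_bigr => i _.
rewrite !euclid_norm_sq /= [z.1 + h.1 - _]addrAC [z.2 + h.2 - _]addrAC; ring.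
Qed.

End EuclidNormContinuity.

(** Along the constant direction with steps [1 / (k * (n + 1))], the test points are convex
    combinations of [u] and [x]. *)
Lemma convex_direction_contingent (R : realType) (X : normedModType R)
    (Omega : set X) (x u : X) (k : R) :
    convex_set (Omega : set (convex_lmodType X)) -> Omega x -> Omega u -> 0 < k ->
  contingent_cone Omega x (k *: (u - x)).
Proof.
move=> cO Ox Ou k0.
exists (fun n => k^-1 * n.+1%:R^-1), (fun=> k *: (u - x)); split.
- by move=> n; rewrite mulr_gt0 ?invr_gt0.
- rewrite -(mulr0 k^-1); apply: cvgMl_tmp; exact: cvg_harmonic.
- exact: cvg_cst.
move=> n; have l0 : 0 <= n.+1%:R^-1 :> R by rewrite invr_ge0.
have l1 : n.+1%:R^-1 <= 1 :> R by rewrite invf_le1// ler1n.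
have -> : x + (k^-1 * n.+1%:R^-1) *: (k *: (u - x)) =
    n.+1%:R^-1 *: u + (1 - n.+1%:R^-1) *: x.
  rewrite scalerA mulrAC mulVf ?gt_eqF// mul1r.
  by rewrite scalerBl scale1r scalerBr addrCA.
by have := cO u x (Itv01 l0 l1); rewrite !inE => /(_ Ou Ox).
Qed.

(** * The variational principle at a local extremal point *)

Section ExtremalPoint.
Context (R : realType) (X Y : completeNormedModType R).

Lemma extremal_penalized_min (Lambda1 Lambda2 : set (X * Y)) (Omega : set X)
    (zbar : X * Y) (r : R) :
    closed Lambda1 -> closed Lambda2 ->
    local_extremal_point Lambda1 Lambda2 Omega zbar -> 0 < r ->
  exists (b : Y) (z1 z2 : X * Y) (w1 w2 : nat -> X * Y) (d : R),
    [/\ Lambda1 z1 /\ Lambda2 z2,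
        `|z1 - zbar| <= r /\ `|z2 - zbar| <= r,
        0 < d /\ 0 < euclid_norm (z1 - z2 + (0, b)),
        forall i, `|z1 - w1 i| <= r /\ `|z2 - w2 i| <= r &
        forall u1 u2, Lambda1 u1 -> Lambda2 u2 ->
          `|u1 - z1| < d -> `|u2 - z2| < d ->
          exists M, forall n, (M <= n)%N ->
          euclid_norm (z1 - z2 + (0, b)) + \sum_(0 <= i < n) dyadic_weight R i *
            (euclid_norm (z1 - w1 i) ^+ 2 + euclid_norm (z2 - w2 i) ^+ 2) <=
          euclid_norm (u1 - u2 + (0, b)) + \sum_(0 <= i < n) dyadic_weight R i *
            (euclid_norm (u1 - w1 i) ^+ 2 + euclid_norm (u2 - w2 i) ^+ 2)].
Proof.
move=> cl1 cl2 [[L1z L2z] _ [b [U [b0 Uz disj]]]] r0.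
have /nbhs_normP[s /= s0 sU] := Uz.
(* The ball of radius [2 * t] around [zbar] lies in [U]. With [m = 1] and initial gap [t ^+ 2 / 2],
   the principle gives [rho] at most [t ^+ 2], hence distances at most [t < r]. *)
pose t := Num.min (r / 2) (s / 4).
have t0 : 0 < t by rewrite lt_min !divr_gt0.
have tr : t < r.
  have : t <= r / 2 by rewrite ge_min lexx.
  lra.
have ts : 2 * t < s.
  have : t <= s / 4 by rewrite ge_min lexx orbT.
  lra.
have t20 : 0 < t ^+ 2 / 2 by rewrite divr_gt0 ?exprn_gt0.
have [k [bk disjk]] : exists k, `|b k| < t ^+ 2 / 2 /\
    [set z + (0, b k) | z in Lambda1] `&` Lambda2 `&` U = set0.
  near \oo => k; exists k; split; last by near: k.
  by near: k; move/cvgr0Pnorm_lt : b0; apply.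
pose T := (((X * Y) * (X * Y))%type : normedModType R).
pose f (w : T) := euclid_norm (w.1 - w.2 + (0, b k)).
pose rho (u v : T) := euclid_norm (u.1 - v.1) ^+ 2 + euclid_norm (u.2 - v.2) ^+ 2.
pose B := closed_ball_ Num.norm zbar (2 * t).
pose S : set T := (fst @^-1` (Lambda1 `&` B)) `&` (snd @^-1` (Lambda2 `&` B)).
have clB : closed B by exact: closed_closed_ball_.
have clS : closed S.
  apply: closedI; (apply: preimage_closed; last exact: closedI) => x _.
    exact: cvg_fst.
  exact: cvg_snd.
have cf : continuous f.
  move=> w; apply: (@continuous_comp _ _ _
    (fun w : T => w.1 - w.2 + (0, b k)) (@euclid_norm R X Y)).
    apply: cvgD; last exact: cvg_cst.
    by apply: cvgB; [exact: cvg_fst | exact: cvg_snd].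
  exact: euclid_norm_continuous.
have crho v : continuous (rho ^~ v).
  move=> w; apply: cvgD.
    apply: (@continuous_comp _ _ _ (fst : T -> X * Y)
      (fun z => euclid_norm (z - v.1) ^+ 2)); first exact: cvg_fst.
    exact: euclid_dist_sq_continuous.
  apply: (@continuous_comp _ _ _ (snd : T -> X * Y)
    (fun z => euclid_norm (z - v.2) ^+ 2)); first exact: cvg_snd.
  exact: euclid_dist_sq_continuous.
have e_0 : euclid_norm (0 : X * Y) = 0.
  by rewrite /euclid_norm /= !normr0 expr0n addr0 sqrtr0.
have rho0 v : rho v v = 0 by rewrite /rho !subrr e_0 expr0n addr0.
have sq_le (u : X * Y) : `|u| ^+ 2 <= euclid_norm u ^+ 2.
  by rewrite ler_pXn2r ?nnegrE ?euclid_norm_ge0 ?norm_le_euclid_norm.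
have rho_ge u v : `|u - v| ^+ 2 <= rho u v.
  rewrite [`|u - v|](prod_normE (u - v)) /Num.max; case: ifP => _.
    by apply: le_trans (sq_le (u.2 - v.2)) _; rewrite lerDr sqr_ge0.
  by apply: le_trans (sq_le (u.1 - v.1)) _; rewrite lerDl sqr_ge0.
have Bz : B zbar by rewrite /B /closed_ball_ /= subrr normr0 mulr_ge0// ltW.
have Sw0 : S (zbar, zbar) by [].
have w0min u : S u -> f (zbar, zbar) <= f u + t ^+ 2 / 2.
  move=> _; apply: (@le_trans _ _ (t ^+ 2 / 2)); last by rewrite lerDr euclid_norm_ge0.
  rewrite /f /= subrr add0r /euclid_norm /= normr0 expr0n add0r sqrtr_sqr normr_id.
  exact: ltW.
have cT : cauchy_complete T.
  by do 2!apply: prod_cauchy_complete; exact: banach_cauchy_complete.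
have [w [[z1 z2] [w0 [[L1z1 Bz1] [L2z2 Bz2]] wP zmin]]] :=
  smooth_variational_principle cT clS cf crho rho0 rho_ge ltr01 t20 Sw0 w0min.
have wt i : `|(z1, z2) - w i| <= t.
  rewrite -(@ler_pXn2r _ 2)// ?nnegrE ?(ltW t0)//.
  by apply: le_trans (rho_ge _ _) _; apply: le_trans (wP i) _; lra.
have wt1 i : `|z1 - (w i).1| <= t.
  by apply: le_trans (wt i); rewrite [leRHS]prod_normE le_max lexx.
have wt2 i : `|z2 - (w i).2| <= t.
  by apply: le_trans (wt i); rewrite [leRHS]prod_normE le_max lexx orbT.
(* The first centre is [(zbar, zbar)], so index 0 locates [z1] and [z2] near [zbar]. *)
have z1t := wt1 0%N; have z2t := wt2 0%N; rewrite w0 /= in z1t z2t.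
exists (b k), z1, z2, (fst \o w), (snd \o w), t; split => //.
- by split; lra.
(* A zero distance would put [z2 = z1 + (0, b k)] in the intersection that extremality makes
   empty. *)
- split => //; rewrite lt_neqAle euclid_norm_ge0 andbT eq_sym.
  apply/eqP => /euclid_norm_eq0 z12.
  have : ([set z + (0, b k) | z in Lambda1] `&` Lambda2 `&` U) z2.
    split; last by apply: sU; apply: le_lt_trans Bz2 ts.
    split => //; exists z1 => //; apply/eqP; rewrite -subr_eq0.
    by rewrite addrAC z12.
  by rewrite disjk.
- by move=> i; have := wt1 i; have := wt2 i; move=> /=; split; lra.
(* Points within [t] of [z1] or [z2] stay within [2 * t] of [zbar], so the constraint [S] holds for
   them. *)
- move=> u1 u2 L1u1 L2u2 uz1 uz2.
  have [|M MP] := zmin (u1, u2).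
    split; split => //; rewrite /B /closed_ball_ /= distrC.
      by have := ler_distD z1 u1 zbar; lra.
    by have := ler_distD z2 u2 zbar; lra.
  by exists M => n /MP; rewrite !mul1r.
Unshelve. all: by end_near. Qed.

End ExtremalPoint.

(** * Construction of the two opposite dual pairs *)

Lemma mem_closed_ballE (R : realType) (V : normedModType R) (x y : V) (r : R) :
  0 < r -> closed_ball x r y = (`|y - x| <= r).
Proof. by move=> r0; rewrite closed_ballE// /closed_ball_ /= distrC. Qed.

Theorem theorem6p2 (R : realType) (X Y : completeNormedModType R)
    (hX : renormed_reflexive X) (hY : renormed_reflexive Y)
    (Omega : set X) (Omega_closed : closed Omega)
    (Omega_convex : convex_set (Omega : set (convex_lmodType X)))
    (Lambda1 Lambda2 : set (X * Y))
    (Lambda1_closed : closed Lambda1) (Lambda2_closed : closed Lambda2)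
    (xbar : X) (ybar : Y)
    (hext : local_extremal_point Lambda1 Lambda2 Omega (xbar, ybar))
    (eps : R) (eps_gt0 : 0 < eps) :
  exists (z1 z2 : X * Y) (p1 p2 : dual X * dual Y),
    [/\ (Lambda1 `&` (closed_ball xbar eps `*` closed_ball ybar eps)) z1
      /\ (Lambda2 `&` (closed_ball xbar eps `*` closed_ball ybar eps)) z2,
        ([set n + e | n in regular_normal_cone z1 Lambda1
            & e in closed_ball (0 : dual X) eps `*` closed_ball (0 : dual Y) eps]
         `&` ((\bigcup_(v in contingent_cone Omega z1.1) duality_map v)
              `*` [set: dual Y])) p1,
        ([set n + e | n in regular_normal_cone z2 Lambda2
            & e in closed_ball (0 : dual X) eps `*` closed_ball (0 : dual Y) eps]
         `&` ((\bigcup_(v in contingent_cone Omega z2.1) duality_map v)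
              `*` [set: dual Y])) p2,
        p1 + p2 = 0
      & euclid_norm p1 + euclid_norm p2 = 1].
Proof.
have [_ _ _ smX] := hX; have [_ _ _ smY] := hY.
have [_ projO _] := hext.
have [b [z1 [z2 [w1 [w2 [d [[L1z1 L2z2] [z1e z2e] [d0 phi0] we zmin]]]]]]] :=
  extremal_penalized_min Lambda1_closed Lambda2_closed hext eps_gt0.
set v := z1 - z2 + (0, b) in phi0 zmin; set phi := euclid_norm v in phi0 zmin.
have Oz1 : Omega z1.1 by apply: projO; exists z1 => //; left.
have Oz2 : Omega z2.1 by apply: projO; exists z2 => //; right.
have [gx Jgx ugx] := frechet_smooth_duality v.1 smX.
have [gy Jgy ugy] := frechet_smooth_duality v.2 smY.
pose k := (2 * phi)^-1; have k0 : 0 < k by rewrite invr_gt0 mulr_gt0.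
have vE1 : z1 - (z2 - (0, b)) = v by rewrite opprB addrA addrAC.
have vE2 : z2 - (z1 + (0, b)) = - v by rewrite /v !opprD opprK addrA [z2 - _]addrC.
(* Freeze [z2] and move [z1] alone, with the distance measured from [z2 - (0, b)]. *)
have [q1 [q11 q12 N1]] : exists q : dual X * dual Y, [/\ `|q.1| <= 1 * eps,
    `|q.2| <= 1 * eps & regular_normal_cone z1 Lambda1
      (- (k *: gx) - q.1, - (k *: gy) - q.2)].
  have := @regular_normal_of_penalized_min _ _ _ Lambda1 z1 (z2 - (0, b)) gx gy
    (fun i => z1 - w1 i) eps 1 d smX smY.
  rewrite vE1; apply => //; first by move=> i; exact: (we i).1.
  move=> h Lh hd.
  have [||M MP] := zmin (z1 + h) z2 Lh L2z2.
  - by rewrite addrAC subrr add0r.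
  - by rewrite subrr normr0.
  exists M => n /MP; have -> : z1 + h - (z2 - (0, b)) = z1 + h - z2 + (0, b).
    by rewrite opprB addrA addrAC.
  rewrite mul1r; exact: penalized_increment.
have [q2 [q21 q22 N2]] : exists q : dual X * dual Y, [/\ `|q.1| <= 1 * eps,
    `|q.2| <= 1 * eps & regular_normal_cone z2 Lambda2
      (- (k *: - gx) - q.1, - (k *: - gy) - q.2)].
  have := @regular_normal_of_penalized_min _ _ _ Lambda2 z2 (z1 + (0, b)) (- gx) (- gy)
    (fun i => z2 - w2 i) eps 1 d smX smY.
  rewrite vE2 euclid_normN; apply => //.
  - exact: sq_norm_upper_gradientN.
  - exact: sq_norm_upper_gradientN.
  - by move=> i; exact: (we i).2.
  move=> h Lh hd.
  have [||M MP] := zmin z1 (z2 + h) L1z1 Lh.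
  - by rewrite subrr normr0.
  - by rewrite addrAC subrr add0r.
  exists M => n /MP; have -> : euclid_norm (z2 + h - (z1 + (0, b))) =
      euclid_norm (z1 - (z2 + h) + (0, b)).
    by rewrite -euclid_normN opprB addrAC.
  (* The penalty of the moving variable must come first to match [penalized_increment]. *)
  under eq_bigr do rewrite addrC.
  under [in X in _ <= X]eq_bigr do rewrite addrC.
  rewrite mul1r; exact: penalized_increment.
rewrite !mul1r in q11 q12 q21 q22.
(* The duality map preserves norms, so [(gx, gy)] has norm [phi], and [k] scales it to one half. *)
have normp : euclid_norm (k *: gx, k *: gy) = 2^-1.
  rewrite -[(_, _)]/(k *: (gx, gy)) euclid_normZ gtr0_norm//.
  rewrite /euclid_norm /= Jgx.2 Jgy.2 -/(euclid_norm v) -/phi /k.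
  by field; rewrite gt_eqF.
(* Dropping [q1] and [q2], which are within [eps], makes the two pairs exactly opposite. *)
exists z1, z2, (- (k *: gx), - (k *: gy)), (k *: gx, k *: gy); split.
- by rewrite /= !mem_closed_ballE //=; split; split => //; split;
    [apply: le_trans z1e | apply: le_trans z1e
    |apply: le_trans z2e | apply: le_trans z2e];
    rewrite prod_normE le_max lexx ?orbT.
- split.
    exists (- (k *: gx) - q1.1, - (k *: gy) - q1.2) => //.
    exists q1; first by split => /=; rewrite mem_closed_ballE// subr0.
    by rewrite [q1]surjective_pairing /= -[LHS]/(_, _) /= !subrK.
  (* The shift [(0, b)] leaves the X-component alone, so this direction is [- k *: v.1], whose
     duality image contains [- (k *: gx)]. *)
  split => //=; exists (k *: (z2.1 - z1.1)).
    exact: convex_direction_contingent.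
  have -> : k *: (z2.1 - z1.1) = - k *: v.1.
    by rewrite /= addr0 scaleNr -scalerN opprB.
  by rewrite -scaleNr; exact: duality_mapZ.
- split.
    exists (- (k *: - gx) - q2.1, - (k *: - gy) - q2.2) => //.
    exists q2; first by split => /=; rewrite mem_closed_ballE// subr0.
    by rewrite [q2]surjective_pairing /= -[LHS]/(_, _) /= !subrK !scalerN !opprK.
  split => //=; exists (k *: (z1.1 - z2.1)).
    exact: convex_direction_contingent.
  have -> : k *: (z1.1 - z2.1) = k *: v.1 by rewrite /= addr0.
  exact: duality_mapZ.
- by rewrite -[LHS]/(_, _) /= !addNr.
- by rewrite -[(- _, - _)]/(- (k *: gx, k *: gy)) euclid_normN normp; field.
Qed.
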